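(* Let $X$ be a reflexive Banach space and $P\in L(X)$. Let $M\colon D(M)\subseteq X\to X$ be linear and closable, with closure $\overline{M}$. Then the following statements are equivalent: (i) $\overline{M}$ is $P$-compatible; (ii) $M$ is n-strongly $P$-compatible.
   Context: For a Banach space $X$, $L(X)$ denotes the bounded linear operators on $X$, $X'$ the dual space, and $|\cdot|$ the norm of $X$. Let $P\in L(X)$ and $N\colon D(N)\subseteq X\to X$ a map. $N$ is $P$-compatible if for all $f,g\in D(N)$, $Pf=Pg$ implies $PN(f)=PN(g)$. $N$ is n-strongly (norm-strongly) $P$-compatible if for all $R>0$ and $x'\in X'$ the map $B_N(0,R)\to X$, $f\mapsto Nf$, is uniformly continuous when $B_N(0,R):=\{f\in D(N): |f|+|Nf|<R\}$ carries the pseudometric $(f,g)\mapsto|P(f-g)|$ and $X$ carries the pseudometric $(u,v)\mapsto|\langle P(u-v),x'\rangle|$. *)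

(* Defs.v *)
From HB Require Import structures.
From mathcomp Require Import all_boot all_order all_algebra.
From mathcomp Require Import complex.
From mathcomp Require Import boolp classical_sets functions reals topology.
From mathcomp Require Import normedtype.

Set Implicit Arguments.
Unset Strict Implicit.
Unset Printing Implicit Defensive.

Import Order.TTheory GRing.Theory Num.Theory numFieldNormedType.Exports.
Local Open Scope classical_set_scope.
Local Open Scope ring_scope.

(* Banach spaces are real or complex. *)
Variant scalar_kind := RealScalars | ComplexScalars.

Definition scalar_field (R : realType) (k : scalar_kind) : numFieldType :=
  match k with
  | RealScalars => R
  | ComplexScalars => R[i]
  end.

Section Duality.
Context {K : numFieldType} (X : completeNormedModType K).

Definition bounded_operator (P : X -> X) : Prop :=
  linear P /\ exists C : K, forall x, `|P x| <= C * `|x|.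

(* The operator norm of the functional x' is at most B. Stated as a bound      *)
(* because suprema are not available in the ordered field K when it is R[i].   *)
Definition dual_norm_le (x' : X -> K) (B : K) : Prop :=
  0 <= B /\ forall x, `|x' x| <= B * `|x|.

Definition dual : set (X -> K) :=
  [set x' | scalar x' /\ exists B, dual_norm_le x' B].

(* Elements of the bidual are maps on [X -> K] of which only the values on     *)
(* [dual] matter; there they are linear, with |phi x'| <= C * |x'|.            *)
Definition bidual : set ((X -> K) -> K) :=
  [set phi |
    (forall (a : K) x' y', dual x' -> dual y' ->
       phi (fun x => a * x' x + y' x) = a * phi x' + phi y') /\
    (exists C : K, forall x' B, dual x' -> dual_norm_le x' B ->
       `|phi x'| <= C * B)].

(* Surjectivity of the canonical embedding of X into its bidual. *)
Definition reflexive_space : Prop :=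
  forall phi, bidual phi -> exists x : X, forall x', dual x' -> phi x' = x' x.

End Duality.

(* A map N : D(N) `<=` X -> X; the values of [pm_fun] outside [pm_dom] are     *)
(* junk and are never consulted below.                                         *)
Record partial_map (X : Type) := PartialMap {
  pm_dom : set X;
  pm_fun :> X -> X
}.

Section PartialMaps.
Context {K : numFieldType} {X : completeNormedModType K}.
Implicit Types (P : X -> X) (M N : partial_map X).

Definition linear_partial_map M : Prop :=
  pm_dom M 0 /\
  forall (a : K) f g, pm_dom M f -> pm_dom M g ->
    pm_dom M (a *: f + g) /\ M (a *: f + g) = a *: M f + M g.

Definition graph N : set (X * X) :=
  [set p | pm_dom N p.1 /\ p.2 = N p.1].

Definition closable M : Prop :=
  forall f g h, closure (graph M) (f, g) -> closure (graph M) (f, h) -> g = h.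

Definition closure_map M : partial_map X :=
  PartialMap [set f | exists g, closure (graph M) (f, g)]
             (fun f => xget 0 [set g | closure (graph M) (f, g)]).

Lemma graph_closure_map M :
  closable M -> graph (closure_map M) = closure (graph M).
Proof.
move=> clM; apply/seteqP; split=> -[f g].
  by move=> [/= fM ->]; exact: (@xgetPex _ 0 [set g | closure (graph M) (f, g)]).
move=> fg; split=> /=; first by exists g.
apply: (clM f) => //.
by apply: (@xgetPex _ 0 [set g | closure (graph M) (f, g)]); exists g.
Qed.

Definition compatible P N : Prop :=
  forall f g, pm_dom N f -> pm_dom N g -> P f = P g -> P (N f) = P (N g).

Definition unif_continuous_on (B : set X) (d e : X -> X -> K) (F : X -> X) :
    Prop :=
  forall eps : K, 0 < eps -> exists2 delta : K, 0 < delta &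
    forall f g, B f -> B g -> d f g < delta -> e (F f) (F g) < eps.

Definition graph_ball N (r : K) : set X :=
  [set f | pm_dom N f /\ `|f| + `|N f| < r].

Definition norm_strongly_compatible P N : Prop :=
  forall (r : K) (x' : X -> K), 0 < r -> dual x' ->
    unif_continuous_on (graph_ball N r)
      (fun f g => `|P (f - g)|) (fun u v => `|x' (P (u - v))|) N.

End PartialMaps.

(* Main.v *)
(** Both directions rest on Hahn-Banach.

If [M] is n-strongly [P]-compatible and (f,g) and (f',g') lie in the closure of
its graph with Pf = Pf', the uniform continuity estimate passes to the limit
and gives x'(Pg) = x'(Pg') for all functionals x', whence Pg = Pg'.

Conversely, if uniform continuity fails for some x', linearity of [M] yields a
graph-norm bounded family of elements h of D(M) with Ph arbitrarily small but
|x'(PMh)| >= eps.  Along an ultrafilter, reflexivity gives weak limits f of h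
and g of Mh.  The closure of the graph is a closed subspace of X * X, hence
weakly closed, so it contains (f,g).  Then Pf = 0, so Pg = 0 by compatibility,
which contradicts |x'(PMh)| >= eps.

Hahn-Banach itself is proved by applying Zorn's lemma to sublinear functionals:
a minimal one is linear. *)

Require Import Defs.
From mathcomp Require Import all_boot all_order all_algebra.
From mathcomp Require Import complex ring lra.
From mathcomp Require Import boolp classical_sets functions reals topology.
From mathcomp Require Import prodnormedzmodule normedtype.

Set Implicit Arguments.
Unset Strict Implicit.
Unset Printing Implicit Defensive.

Import Order.TTheory GRing.Theory Num.Theory numFieldNormedType.Exports.
Local Open Scope classical_set_scope.
Local Open Scope ring_scope.

(** * Hahn-Banach for real-valued sublinear functionals *)

Section HahnBanach.
Context {R : realType} {K : nzRingType} (emb : {rmorphism R -> K}).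
Context {V : lmodType K}.
Implicit Types (p q : V -> R) (A : set (V -> R)).

(** Real scalars act through [emb], so that real and complex spaces are treated at once. Homogeneity
    is asked as an inequality, which infima inherit more easily; [sublinearZ] recovers equality by
    scaling back with the inverse of [t]. *)
Definition sublinear q : Prop :=
  (forall x y, q (x + y) <= q x + q y) /\
  (forall t x, 0 <= t -> q (emb t *: x) <= t * q x).

Definition real_linear (u : V -> R) : Prop :=
  (forall x y, u (x + y) = u x + u y) /\
  (forall t x, u (emb t *: x) = t * u x).

Lemma sublinear0 q : sublinear q -> q 0 = 0.
Proof.
move=> [qD qZ]; apply/eqP; rewrite eq_le; apply/andP; split.
  by have := qZ 0 0 (lexx _); rewrite mul0r scaler0.
by have := qD 0 0; rewrite addr0; lra.
Qed.

Lemma sublinearZ q t x : sublinear q -> 0 <= t -> q (emb t *: x) = t * q x.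
Proof.
move=> sq; rewrite le_eqVlt => /predU1P[<-|t0].
  by rewrite rmorph0 scale0r mul0r sublinear0.
case: sq => _ qZ; apply/eqP; rewrite eq_le qZ ?(ltW t0)//=.
have := qZ t^-1 (emb t *: x); rewrite invr_ge0 ltW// => /(_ isT).
by rewrite scalerA -rmorphM mulVf ?gt_eqF// rmorph1 scale1r ler_pdivlMl.
Qed.

Lemma sublinear_opp q x : sublinear q -> - q (- x) <= q x.
Proof.
move=> sq; have := sq.1 x (- x).
by rewrite subrr sublinear0//; lra.
Qed.

Definition inf_family A x : R := inf [set q x | q in A].

Lemma inf_family_le A q x : (forall y, has_lbound [set q y | q in A]) ->
  A q -> inf_family A x <= q x.
Proof. by move=> Alb Aq; apply: ge_inf => //; exists q. Qed.

Lemma le_inf_family A x c : A !=set0 ->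
  (forall q, A q -> c <= q x) -> c <= inf_family A x.
Proof.
move=> [q0 Aq0] Ac; apply: lb_le_inf; first by exists (q0 x), q0.
by move=> _ [q Aq <-]; exact: Ac.
Qed.

(** Serves three families: the shifts of a functional, a chain in Zorn's lemma, and the distances to
    the points of a subspace. Each is closed under sums and scaling only up to domination, hence the
    existential hypotheses. *)
Lemma sublinear_inf A : A !=set0 ->
  (forall x, has_lbound [set q x | q in A]) ->
  (forall q1 q2 x y, A q1 -> A q2 ->
     exists2 q, A q & q (x + y) <= q1 x + q2 y) ->
  (forall q t x, A q -> 0 <= t ->
     exists2 q', A q' & q' (emb t *: x) <= t * q x) ->
  sublinear (inf_family A).
Proof.
move=> A0 Alb AD AZ; split=> [x y|t x].
  rewrite -lerBlDr; apply: le_inf_family => // q1 Aq1.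
  rewrite lerBlDr -lerBlDl; apply: le_inf_family => // q2 Aq2.
  rewrite lerBlDl; have [q Aq] := AD _ _ x y Aq1 Aq2.
  by apply: le_trans; exact: inf_family_le.
have Z q s : A q -> 0 <= s -> inf_family A (emb s *: x) <= s * q x.
  move=> Aq s0; have [q' Aq'] := AZ q s x Aq s0.
  by apply: le_trans; exact: inf_family_le.
rewrite le_eqVlt => /predU1P[<-|t0].
  by have [q Aq] := A0; have := Z q 0 Aq (lexx _); rewrite !mul0r.
rewrite mulrC -ler_pdivrMr//; apply: le_inf_family => // q Aq.
by rewrite ler_pdivrMr// mulrC Z// ltW.
Qed.

(** Take the infimum over t >= 0 of q(x + ty) - t q(y). The values t = 0 and t = 1 give the two
    upper bounds; subadditivity gives the lower bound -q(-x). *)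
Lemma sublinear_shift q y : sublinear q ->
  exists q', [/\ sublinear q', (forall x, q' x <= q x) &
    forall x, q' x <= q (x + y) - q y].
Proof.
move=> sq; pose f (t : R) x := q (x + emb t *: y) - t * q y.
pose A := [set f t | t in [set t | 0 <= t]].
have Alb x : has_lbound [set g x | g in A].
  exists (- q (- x)) => _ [_ [t /= t0 <-] <-]; rewrite /f -(sublinearZ y sq t0).
  by have := sq.1 (x + emb t *: y) (- x); rewrite addrAC subrr add0r; lra.
exists (inf_family A); split.
- apply: sublinear_inf => //.
  + by exists (f 0), 0 => /=.
  + move=> _ _ x z [s /= s0 <-] [t /= t0 <-].
    exists (f (s + t)); first by exists (s + t) => //=; exact: addr_ge0.
    have := sq.1 (x + emb s *: y) (z + emb t *: y).
    by rewrite /f rmorphD scalerDl addrACA; lra.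
  + move=> _ t x [s /= s0 <-] t0.
    exists (f (t * s)); first by exists (t * s) => //=; exact: mulr_ge0.
    have := sq.2 t (x + emb s *: y) t0.
    by rewrite /f rmorphM -scalerA -scalerDr; lra.
- move=> x; have -> : q x = f 0 x by rewrite /f rmorph0 scale0r addr0; lra.
  by apply: inf_family_le => //; exists 0 => /=.
- move=> x; have -> : q (x + y) - q y = f 1 x.
    by rewrite /f rmorph1 scale1r; lra.
  by apply: inf_family_le => //; exists 1 => //=.
Qed.

(** By minimality the shift of [q] along [y] is [q] itself, so its second bound reads q(x) + q(y) <=
    q(x + y), the converse of subadditivity. Additivity makes [q] odd, which settles negative
    scalars. *)
Lemma minimal_sublinear_real_linear q : sublinear q ->
  (forall q', sublinear q' -> (forall x, q' x <= q x) -> q' = q) ->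
  real_linear q.
Proof.
move=> sq qmin.
have qD x y : q (x + y) = q x + q y.
  have [q' [sq' q'q q'y]] := sublinear_shift y sq.
  have := q'y x; rewrite (qmin _ sq' q'q).
  by have := sq.1 x y; lra.
have qN x : q (- x) = - q x.
  by have := qD x (- x); rewrite subrr sublinear0//; lra.
split=> // t x; have [t0|t0] := leP 0 t; first exact: sublinearZ.
have -> : emb t *: x = - (emb (- t) *: x) by rewrite rmorphN scaleNr opprK.
by rewrite qN sublinearZ//; lra.
Qed.

Lemma minimal_sublinear_exists p : sublinear p ->
  exists q, [/\ sublinear q, (forall x, q x <= p x) &
    forall q', sublinear q' -> (forall x, q' x <= q x) -> q' = q].
Proof.
move=> sp; pose T := {q : V -> R | sublinear q /\ forall x, q x <= p x}.
(* The order is reversed, so that a maximal element for Zorn is a minimal functional. *)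
pose le (q1 q2 : T) := `[< forall x, sval q2 x <= sval q1 x >].
have [||||[q [sq qp]] qmax] := @Zorn T le.
- by move=> q; apply/asboolP.
- move=> q1 q2 q3 /asboolP q12 /asboolP q23; apply/asboolP => x.
  exact: le_trans (q23 x) (q12 x).
- move=> [q1 P1] [q2 P2] /asboolP /= q12 /asboolP /= q21.
  apply: eq_exist => /=; apply/funext => x; apply/eqP.
  by rewrite eq_le q12 q21.
(* The empty chain is bounded by [p], a nonempty one by its pointwise infimum, which is finite
   because every member is at least -p(-x). *)
- move=> C totC; have [[c Cc]|C0] := pselect (C !=set0); last first.
    exists (exist _ p (conj sp (fun x => lexx (p x)))) => s Cs.
    by exfalso; apply: C0; exists s.
  pose A := [set sval c | c in C].
  have AP q : A q -> sublinear q /\ forall x, q x <= p x.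
    by move=> [s _ <-]; exact: (svalP s).
  have Alb x : has_lbound [set q x | q in A].
    exists (- p (- x)) => _ [q /AP[sq qp] <-].
    by apply: le_trans (sublinear_opp x sq); rewrite lerN2.
  have sA : sublinear (inf_family A).
    apply: sublinear_inf => //; first by exists (sval c), c.
    + move=> _ _ x y [c1 C1 <-] [c2 C2 <-].
      have [/asboolP|/asboolP] := totC _ _ C1 C2 => c12.
        exists (sval c2); first by exists c2.
        by apply: le_trans ((svalP c2).1.1 x y) _; rewrite lerD2r.
      exists (sval c1); first by exists c1.
      by apply: le_trans ((svalP c1).1.1 x y) _; rewrite lerD2l.
    + by move=> q t x Aq t0; exists q => //; exact: (AP q Aq).1.2.
  have Ap x : inf_family A x <= p x.
    apply: le_trans ((svalP c).2 x); apply: inf_family_le => //.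
    by exists c.
  exists (exist _ (inf_family A) (conj sA Ap)) => s Cs; apply/asboolP => x /=.
  by apply: inf_family_le => //; exists s.
exists q; split=> // q' sq' q'q.
have q'p x : q' x <= p x := le_trans (q'q x) (qp x).
have := qmax (exist _ q' (conj sq' q'p)).
by move=> /(_ (asboolT q'q))/(congr1 sval).
Qed.

(** Minimizing below the shift of [p] along [y], rather than below [p], forces the value at [y]: the
    shift at -y is at most p(0) - p(y) = -p(y), so u(-y) <= -p(y) and u(y) >= p(y). *)
Lemma Hahn_Banach p y : sublinear p ->
  exists u, [/\ real_linear u, (forall x, u x <= p x) & u y = p y].
Proof.
move=> sp; have [p' [sp' p'p p'y]] := sublinear_shift y sp.
have [u [su up' umin]] := minimal_sublinear_exists sp'.
have lu := minimal_sublinear_real_linear su umin.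
have up x : u x <= p x := le_trans (up' x) (p'p x).
exists u; split=> //; apply/eqP; rewrite eq_le up/=.
have := lu.1 y (- y); have := p'y (- y); have := up' (- y).
rewrite addNr subrr sublinear0// (sublinear0 su); lra.
Qed.

End HahnBanach.

(** * Real and complex scalars: complexification and limits along ultrafilters *)

Section ScalarField.
Context {R : realType}.

Definition of_real k : {rmorphism R -> scalar_field R k} :=
  match k with
  | RealScalars => idfun
  | ComplexScalars => real_complex R
  end.

Definition re_part k : scalar_field R k -> R :=
  match k with
  | RealScalars => id
  | ComplexScalars => @complex.Re R
  end.

Lemma norm_of_real k (a : R) : `|of_real k a| = of_real k `|a|.
Proof.
by case: k => //=; rewrite normc_def /= expr0n addr0 sqrtr_sqr.
Qed.

Context {k : scalar_kind}.
Notation K := (scalar_field R k).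

Lemma of_realK (a : R) : re_part (of_real k a) = a.
Proof. by case: k. Qed.

Lemma re_partM (a : R) (z : K) : re_part (of_real k a * z) = a * re_part z.
Proof. by case: k z => //= -[? ?] /=; rewrite mul0r subr0. Qed.

Lemma ge0_re_partK (z : K) : 0 <= z -> of_real k (re_part z) = z.
Proof. by case: k z => //= z /ger0_real /RRe_real. Qed.

Lemma of_real_le (a b : R) : (of_real k a <= of_real k b) = (a <= b).
Proof. by case: k => //=; exact: lecR. Qed.

(* Over the complex numbers a real-linear [u] is the real part of the
   complex-linear [x |-> u x - i * u (i * x)]. *)
Lemma complexification (V : normedModType K) (u : V -> R) :
  real_linear (of_real k) u -> (forall x, `|u x| <= re_part `|x|) ->
  exists F : V -> K, [/\ scalar F, forall x, `|F x| <= 2 * `|x|,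
    forall x, re_part (F x) = u x &
    forall x, (forall a, u (a *: x) = 0) -> F x = 0].
Proof.
case: k V u => V u [uD uZ] ule.
- exists u; split=> //.
  + by move=> a x y /=; rewrite uD uZ.
  + move=> x; apply: le_trans (ule x) _.
    by apply: ler_peMl; [exact: normr_ge0 | exact: (ler1n R 2)].
  + by move=> x /(_ 1); rewrite scale1r.
- pose F (x : V) : R[i] := (u x -i* u ('i *: x))%C.
  have uZc (b c : R) x : u ((b +i* c)%C *: x) = b * u x + c * u ('i%C *: x).
    rewrite -!uZ -uD /= scalerA -scalerDl; congr (u (_ *: _)).
    by rewrite [LHS]complexE /= mulrC.
  exists F; split.
  + move=> [b c] x y; rewrite /F /= scalerDr !uD scalerA (uZc b c).
    have -> : ('i * (b +i* c))%C = ((- c) +i* b)%C :> R[i].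
      by apply/eqP; rewrite eq_complex /=; apply/andP; split; apply/eqP; ring.
    rewrite (uZc (- c) b); apply/eqP; rewrite eq_complex /=.
    by apply/andP; split; apply/eqP; ring.
  (* The factor 2 arises from bounding the real and imaginary parts of [F x] separately, each by the
     norm of [x]. *)
  + have nu x : `|(u x)%:C%C : R[i]| <= `|x|.
      rewrite normc_def /= expr0n addr0 sqrtr_sqr -[leRHS]RRe_real ?normr_real//.
      by rewrite lecR ule.
    move=> x; rewrite [F x]complexE; apply: le_trans (ler_normD _ _) _.
    rewrite mulr_natl mulr2n; apply: lerD; first exact: nu.
    have ni : `|'i%C : R[i]| = 1 by rewrite normc_def /= expr0n expr1n add0r sqrtr1.
    rewrite normrM ni mul1r rmorphN normrN; apply: le_trans (nu _) _.
    by rewrite normrZ ni mul1r.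
  + by move=> x; done.
  + by move=> x ux; rewrite /F (ux 'i%C) -[x in u x]scale1r ux oppr0.
Qed.

(** The image ultrafilter contains a compact segment and so clusters at some [l]. It contains each
    ball around [l] or its complement, and clustering excludes the complement. *)
Lemma real_ultra_bounded_cvg I (U : set_system I) (s : I -> R) (C : R) :
  UltraFilter U -> U [set i | `|s i| <= C] -> exists l : R, s @ U --> l.
Proof.
move=> UU sC.
have sI : (s @ U) `[(- C), C]%classic.
  have := sC; rewrite /fmap /=; apply: (@filterS _ U) => i /=.
  by rewrite in_itv/= ler_norml.
have [l [_ cl]] := segment_compact _ sI.
exists l; apply/cvgrPdist_lt => e e0.
have [//|H] := in_ultra_setVsetC [set i | `|l - s i| < e] UU.
have [|x [/= nle le]] := cl (~` [set x | `|l - x| < e]) [set x | `|l - x| < e] H.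
  by apply/nbhs_normP; exists e.
by case: nle.
Qed.

Lemma ultra_bounded_cvg I (U : set_system I) (s : I -> K) (C : K) :
  UltraFilter U -> U [set i | `|s i| <= C] -> exists l : K, s @ U --> l.
Proof.
case: k s C => s C UU sC; first exact: real_ultra_bounded_cvg sC.
have part (f : R[i] -> R) : (forall z, (`|f z|%:C)%C <= `|z|) ->
    exists l : R, f \o s @ U --> l.
  move=> fle; apply: (@real_ultra_bounded_cvg _ U (f \o s) (complex.Re C)).
  have := sC; apply: (@filterS _ U) => i /= siC.
  by have := le_trans (fle _) siC; rewrite lecE /= => /andP[].
have [a sa] : exists a : R, (fun i => complex.Re (s i)) @ U --> a.
  by apply: part => z; exact: normc_ge_Re.
have [b sb] : exists b : R, (fun i => complex.Im (s i)) @ U --> b.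
  (* Multiplication by i keeps the modulus and turns the imaginary part into minus the real part. *)
  apply: part => z; have := normc_ge_Re (z * 'i%C).
  by rewrite ReiNIm normrN normrM [`|'i%C|]normc_def /= expr0n expr1n add0r sqrtr1 mulr1.
exists (a +i* b)%C; apply/cvgrPdist_lt => e e0.
(* A positive [e] in [R[i]] is real, so half of its real part is a tolerance for each component. *)
have re0 : 0 < complex.Re e / 2 by move: e0; rewrite ltcE/= => /andP[_]; lra.
move/cvgrPdist_lt/(_ _ re0) : sa; move/cvgrPdist_lt/(_ _ re0) : sb.
apply: filterS2 => i /= ib ia.
rewrite [X in `|X|]complexE; apply: le_lt_trans (ler_normD _ _) _.
rewrite normrM [`|'i%C|]normc_def /= expr0n expr1n add0r sqrtr1 mul1r.
have -> : e = (complex.Re e)%:C%C by rewrite RRe_real ?gtr0_real.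
have nR (c : R) : `|(c%:C)%C| = (`|c|%:C)%C :> R[i] by exact: (@norm_of_real ComplexScalars).
rewrite !nR -rmorphD /= ltcR; move: ia ib.
by case: (s i) => c d /= ia ib; lra.
Qed.

End ScalarField.

Lemma closure_normP (K : numFieldType) (V : normedModType K) (A : set V) x :
  closure A x <-> forall e : K, 0 < e -> exists2 y, A y & `|x - y| < e.
Proof.
split=> [clx e e0|H B /nbhs_normP[e /= e0 eB]].
  have [|y [Ay /= xy]] := clx [set y | `|x - y| < e].
    by apply/nbhs_normP; exists e.
  by exists y.
by have [y Ay xy] := H _ e0; exists y; split=> //; exact: eB.
Qed.

(** * Separation of points from subspaces by bounded functionals *)

Section Separation.
Context {R : realType} {k : scalar_kind}.
Notation K := (scalar_field R k).

Section RealNorm.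
Context {V : normedModType K}.
Implicit Types x y : V.

(** The norm of [V] takes values in [K]; infima and [Hahn_Banach] require values in [R]. *)
Definition rnorm x : R := re_part `|x|.

Lemma rnormE x : of_real k (rnorm x) = `|x|.
Proof. by rewrite ge0_re_partK. Qed.

Lemma rnorm_ge0 x : 0 <= rnorm x.
Proof. by rewrite -(of_real_le (k := k)) rnormE rmorph0. Qed.

Lemma rnormD x y : rnorm (x + y) <= rnorm x + rnorm y.
Proof. by rewrite -(of_real_le (k := k)) rmorphD !rnormE ler_normD. Qed.

Lemma rnormN x : rnorm (- x) = rnorm x.
Proof. by rewrite /rnorm normrN. Qed.

Lemma rnormZ t x : 0 <= t -> rnorm (of_real k t *: x) = t * rnorm x.
Proof. by move=> t0; rewrite /rnorm normrZ norm_of_real ger0_norm// re_partM. Qed.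

End RealNorm.

(** Apply Hahn-Banach to the distance to [G], which is sublinear, at most the norm, zero on [G] and
    positive at [y]. The resulting [u] is odd, so upper bounds at x and -x give both its norm bound
    and its vanishing on [G]; then complexify. *)
Lemma separate_from_subspace (V : normedModType K) (G : set V) (y : V) :
  G 0 -> (forall a x z, G x -> G z -> G (a *: x + z)) -> ~ closure G y ->
  exists F : V -> K, [/\ scalar F, forall x, `|F x| <= 2 * `|x|,
    forall x, G x -> F x = 0 & F y != 0].
Proof.
move=> G0 Glin nGy.
have GZ a x : G x -> G (a *: x).
  by move=> Gx; rewrite -[_ *: _]addr0; exact: Glin.
pose A := [set (fun x => rnorm (x - g)) | g in G].
have Alb x : has_lbound [set q x | q in A].
  by exists 0 => _ [_ [g _ <-] <-]; exact: rnorm_ge0.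
pose p := inf_family A.
have sp : sublinear (of_real k) p.
  apply: sublinear_inf => //.
  - by exists (fun x => rnorm (x - 0)), 0.
  - move=> _ _ x z [g Gg <-] [h Gh <-].
    exists (fun x => rnorm (x - (g + h))).
      by exists (g + h) => //; rewrite -[g]scale1r; exact: Glin.
    by rewrite opprD addrACA; exact: rnormD.
  - move=> _ t x [g Gg <-] t0.
    exists (fun x => rnorm (x - of_real k t *: g)).
      by exists (of_real k t *: g) => //; exact: GZ.
    by rewrite -scalerBr rnormZ.
have pn x : p x <= rnorm x.
  rewrite -[x in leRHS]subr0; have : A (fun x => rnorm (x - 0)) by exists 0.
  by move/(inf_family_le x Alb).
have pG x : G x -> p x <= 0.
  move=> Gx; have : A (fun z => rnorm (z - x)) by exists x.
  by move/(inf_family_le x Alb); rewrite subrr /rnorm normr0 -(rmorph0 (of_real k)) of_realK.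
have py : 0 < p y.
  (* If the distance were not positive, [G] would have points within every [e] of [y]. *)
  rewrite ltNge; apply/negP => py0; apply: nGy; apply/closure_normP => e e0.
  have re0 : 0 < re_part e.
    rewrite lt_neqAle -(of_real_le (k := k)) rmorph0 ge0_re_partK ?ltW// andbT.
    by apply/eqP => e'; have := e0; rewrite -(ge0_re_partK (ltW e0)) -e' rmorph0 ltxx.
  have hA : has_inf [set q y | q in A].
    by split; [exists (rnorm (y - 0)), (fun x => rnorm (x - 0)) => //; exists 0|].
  have [_ [_ [g Gg <-] <-]] := inf_adherent re0 hA.
  rewrite -/(inf_family A y) -/p => yg; exists g => //.
  rewrite -rnormE -(ge0_re_partK (ltW e0)) lt_neqAle of_real_le.
  have ltr : rnorm (y - g) < re_part e by move: yg py0; lra.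
  rewrite ltW// andbT; apply/eqP => /(congr1 (@re_part _ _)).
  by rewrite !of_realK => h; move: ltr; rewrite h ltxx.
have [u [lu up uy]] := Hahn_Banach y sp.
have uN x : u (- x) = - u x.
  by have := lu.2 (-1) x; rewrite rmorphN1 scaleN1r mulN1r.
have un x : `|u x| <= rnorm x.
  rewrite ler_norml (le_trans (up x) (pn x)) andbT lerNl -uN.
  by rewrite -rnormN (le_trans (up _) (pn _)).
have uG x : G x -> u x = 0.
  move=> Gx; apply/eqP; rewrite eq_le (le_trans (up x) (pG _ Gx))/=.
  by rewrite -oppr_le0 -uN (le_trans (up _) (pG _ _))// -scaleN1r; exact: GZ.
have [F [Flin Fle Fu F0]] := complexification lu un.
(* Since [G] is stable under all scalars of [K], [u] kills every multiple of [x], as the last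
   property of [F] demands. *)
exists F; split=> //; first by move=> x Gx; apply: F0 => a; exact/uG/GZ.
apply/eqP => Fy; have := Fu y.
by rewrite Fy -(rmorph0 (of_real k)) of_realK uy => py0; move: py; rewrite -py0 ltxx.
Qed.

Context {X : completeNormedModType K}.

Lemma dual_separates (x : X) : (forall x', dual x' -> x' x = 0) -> x = 0.
Proof.
move=> dx; apply: contrapT => x0.
have [|||F [Flin Fle _ /eqP[]]] := @separate_from_subspace X [set 0] x.
- by [].
- by move=> a y z -> ->; rewrite scaler0 addr0.
- move=> /closure_normP H; have nx : 0 < `|x| by rewrite normr_gt0; exact/eqP.
  by have [_ ->] := H _ nx; rewrite subr0 ltxx.
apply: dx; split=> //; exists 2; split=> //; exact: ler0n.
Qed.

(** A separating functional on the product is the sum of its restrictions to the two axes; these are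
    bounded because the axes embed isometrically for the max norm. This is how closed subspaces of X
    * X are seen to be weakly closed. *)
Lemma dual_separates_subspace (G : set (X * X)) (p : X * X) :
  G 0 -> (forall a q r, G q -> G r -> G (a *: q + r)) -> ~ closure G p ->
  exists x' y', [/\ dual x', dual y',
    forall q, G q -> x' q.1 + y' q.2 = 0 & x' p.1 + y' p.2 != 0].
Proof.
move=> G0 Glin nGp.
have [F [Flin Fle FG Fp]] := @separate_from_subspace (X * X)%type G p G0 Glin nGp.
have FE (q : X * X) : F (q.1, 0) + F (0, q.2) = F q.
  rewrite -[F (q.1, 0)]mul1r -Flin scale1r; congr F.
  by case: q => a b; congr pair => /=; rewrite ?addr0 ?add0r.
have dualF (i : X -> X * X) : linear i -> (forall x, `|i x| = `|x|) -> dual (F \o i).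
  move=> ilin ni; split=> [a x z|]; first by rewrite /= ilin Flin.
  by exists 2; split=> [|x]; [exact: ler0n | rewrite -ni; exact: Fle].
exists (F \o (fun x => (x, 0))), (F \o (fun x => (0, x))); split.
- apply: dualF => [a x z|x]; last by rewrite prod_normE /= normr0 max_l.
  by congr pair => //=; rewrite scaler0 addr0.
- apply: dualF => [a x z|x]; last by rewrite prod_normE /= normr0 max_r.
  by congr pair => //=; rewrite scaler0 addr0.
- by move=> q Gq; rewrite /= FE FG.
- by rewrite /= FE.
Qed.

End Separation.

(** Stands in for a minimum: the order of [K] is only partial, but positive elements are real and
    hence comparable. *)
Lemma pos_le2 (K : numFieldType) (a b : K) : 0 < a -> 0 < b ->
  exists2 c, 0 < c & c <= a /\ c <= b.
Proof.
move=> a0 b0; have /orP[ab|ba] : (a <= b) || (b <= a).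
- by rewrite real_leVge// gtr0_real.
- by exists a.
- by exists b.
Qed.

(** * Bounded operators, functionals and linear graphs *)

Section BoundedOperators.
Context {K : numFieldType} {X : completeNormedModType K}.
Implicit Types (P : X -> X) (M : partial_map X).

Lemma bounded_operator_ge0 P : bounded_operator P ->
  exists2 C : K, 0 <= C & forall x, `|P x| <= C * `|x|.
Proof.
(* The given [C] may be negative when X = 0, so its absolute value is taken. *)
move=> [_ [C PC]]; exists `|C| => // x.
have Cx : 0 <= C * `|x| by apply: le_trans (PC x).
by rewrite -[`|x|]normr_id -normrM ger0_norm.
Qed.

Lemma bounded_operatorB P : bounded_operator P -> {morph P : x y / x - y}.
Proof.
move=> [Plin _] x y; by rewrite -[- y]scaleN1r addrC Plin scaleN1r addrC.
Qed.

Lemma dualB (x' : X -> K) : dual x' -> {morph x' : x y / x - y}.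
Proof.
by move=> [lin _] x y; rewrite -[- y]scaleN1r addrC lin mulN1r addrC.
Qed.

Lemma dual_comp P (x' : X -> K) :
  bounded_operator P -> dual x' -> dual (x' \o P).
Proof.
move=> bP [lin [B [B0 x'B]]]; have [C C0 PC] := bounded_operator_ge0 bP.
split=> [a x y|]; first by rewrite /= bP.1 lin.
exists (B * C); split=> [|x]; first exact: mulr_ge0.
by apply: le_trans (x'B _) _; rewrite -mulrA ler_wpM2l.
Qed.

Lemma linear_partial_mapB M f g : linear_partial_map M ->
  pm_dom M f -> pm_dom M g -> pm_dom M (f - g) /\ M (f - g) = M f - M g.
Proof.
move=> [_ lM] Mf Mg; have := lM (-1) g f Mg Mf.
by rewrite !scaleN1r ![- _ + _]addrC.
Qed.

Lemma graph_linear M : linear_partial_map M ->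
  graph M 0 /\ forall a p q, graph M p -> graph M q -> graph M (a *: p + q).
Proof.
move=> [M0 lM]; split.
  split=> //=; have := (lM 1 0 0 M0 M0).2.
  by rewrite !scale1r addr0 => /(congr1 (fun z => z - M 0)); rewrite subrr addrK.
move=> a [f _] [g _] [/= Mf ->] [/= Mg ->].
by have [Dfg Mfg] := lM a f g Mf Mg; split=> //=; rewrite Mfg.
Qed.

End BoundedOperators.

(** * Weak limits in reflexive spaces *)

Section WeakLimits.
Context {R : realType} {k : scalar_kind}.
Notation K := (scalar_field R k).
Context {X : completeNormedModType K}.

(** The limits of x'(s i) along the ultrafilter exist by boundedness and define an element [phi] of
    the bidual; reflexivity represents it by a point. *)
Lemma reflexive_weak_limit I (U : set_system I) (s : I -> X) (C : K) :
  reflexive_space X -> UltraFilter U -> U [set i | `|s i| <= C] ->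
  exists x, forall x', dual x' -> x' (s i) @[i --> U] --> x' x.
Proof.
move=> reflX UU sC; pose phi (x' : X -> K) : K := lim (x' (s i) @[i --> U]).
have phiP x' : dual x' -> x' (s i) @[i --> U] --> phi x'.
  move=> [_ [B [B0 x'B]]].
  have [|l sl] := @ultra_bounded_cvg R k I U (x' \o s) (B * C) UU.
    have := sC; apply: (@filterS _ U) => i /= siC.
    by apply: le_trans (x'B _) _; rewrite ler_wpM2l.
  by rewrite /phi (cvg_lim _ sl).
have [|x xP] := reflX phi; last first.
  by exists x => x' dx'; rewrite -xP//; exact: phiP.
split=> [a x' y' dx' dy'|].
  apply/cvg_lim => //; apply: cvgD; last exact: phiP.
  by apply: cvgMr; exact: phiP.
(* The bound on [phi] is shown up to [e], at an index where x'(s i) is [e]-close to [phi x'] and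
   [s i] is bounded by [C]. *)
exists C => x' B dx' [B0 x'B]; apply/ler_addgt0Pr => e e0.
have /cvgrPdist_lt/(_ _ e0) phie := phiP x' dx'.
have [i [/= ie siC]] := @filter_ex _ U _ _ (filterI phie sC).
rewrite -[phi x'](subrK (x' (s i))) addrC; apply: le_trans (ler_normD _ _) _.
rewrite lerD ?(ltW ie)//; apply: le_trans (x'B _) _.
by rewrite mulrC ler_wpM2r.
Qed.

End WeakLimits.

(** * The two implications *)

Section Compatibility.
Context {R : realType} {k : scalar_kind}.
Notation K := (scalar_field R k).
Context {X : completeNormedModType K}.
Context (P : X -> X) (M : partial_map X).
Context (bP : bounded_operator P) (lM : linear_partial_map M) (clM : closable M).

Lemma compatible_closure_strong : reflexive_space X ->
  compatible P (closure_map M) -> norm_strongly_compatible P M.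
Proof.
move=> reflX cP r x' r0 dx' eps eps0; apply: contrapT => nunif.
(* Differences of pairs violating uniform continuity at [d]; the bound r + r is the triangle
   inequality. These sets shrink with [d] and generate a proper filter. *)
pose S (d : K) := [set h | [/\ pm_dom M h, `|h| <= r + r, `|M h| <= r + r,
  `|P h| < d & ~ `|x' (P (M h))| < eps]].
have S0 d : 0 < d -> S d !=set0.
  move=> d0; apply: contrapT => Sd0; apply: nunif; exists d => // f g.
  move=> [Mf fr] [Mg gr] Pfg; apply: contrapT => nfg; apply: Sd0.
  have [Dfg Mfg] := linear_partial_mapB lM Mf Mg.
  exists (f - g); split=> //; last by rewrite Mfg.
  - apply: le_trans (ler_normB _ _) (lerD _ _).
      by apply: le_trans (ltW fr); rewrite lerDl.
    by apply: le_trans (ltW gr); rewrite lerDl.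
  - rewrite Mfg; apply: le_trans (ler_normB _ _) (lerD _ _).
      by apply: le_trans (ltW fr); rewrite lerDr.
    by apply: le_trans (ltW gr); rewrite lerDr.
pose F := filter_from [set d : K | 0 < d] S.
have FF : ProperFilter F.
  apply: filter_from_proper => //.
  apply: filter_from_filter; first by exists 1 => /=; exact: ltr01.
  move=> c d /= c0 d0; have [m m0 [mc md]] := pos_le2 c0 d0; exists m => //.
  by move=> h [Mh hr Mhr Ph nx]; split; split=> //; apply: lt_le_trans Ph _.
have [U [UU FU]] := ultraFilterLemma FF.
have US d : 0 < d -> U (S d) by move=> d0; apply: FU; exists d.
have US1 := US 1 ltr01.
have [|f fP] := @reflexive_weak_limit R k X X U id (r + r) reflX UU.
  by have := US1; apply: (@filterS _ U) => h [].
have [|g gP] := @reflexive_weak_limit R k X X U M (r + r) reflX UU.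
  by have := US1; apply: (@filterS _ U) => h [].
have clfg : closure (graph M) (f, g).
  (* A functional vanishing on the graph is zero along (h, M h), hence zero at the weak limit (f,
     g), so it cannot separate that point. *)
  apply: contrapT => nfg; have [G0 Glin] := graph_linear lM.
  have [y' [z' [dy' dz' yzG /eqP[] /=]]] := dual_separates_subspace G0 Glin nfg.
  apply: (@cvg_unique _ _ (y' h + z' (M h) @[h --> U])) => //.
    by apply: cvgD; [exact: fP | exact: gP].
  apply/cvgrPdist_lt => e e0.
  have := US1; apply: (@filterS _ U) => h [Mh _ _ _ _].
  by rewrite (yzG (h, M h)) // subrr normr0.
(* Each z'(P h) tends to z'(P f) weakly, and to 0 because P h tends to 0 in norm. *)
have Pf0 : P f = 0.
  apply: dual_separates => z' dz'.
  apply: (@cvg_unique _ _ (z' (P h) @[h --> U])) => //.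
    exact: (fP _ (dual_comp bP dz')).
  have [_ [B [B0 z'B]]] := dz'.
  (* [B] may be zero; B + 1 can be divided by. *)
  have B1 : 0 < B + 1 by rewrite ltr_wpDl.
  apply/cvgrPdist_lt => e e0.
  have := US (e / (B + 1)) (divr_gt0 e0 B1); apply: (@filterS _ U).
  move=> h [_ _ _ Ph _]; rewrite sub0r normrN.
  apply: le_lt_trans (z'B _) _; apply: (@le_lt_trans _ _ ((B + 1) * `|P h|)).
    by rewrite ler_wpM2r// lerDl.
  by rewrite mulrC -ltr_pdivlMr.
have P0 : P 0 = 0 by rewrite -[in LHS](subrr 0) (bounded_operatorB bP) subrr.
have E p : closure (graph M) p -> graph (closure_map M) p.
  by rewrite graph_closure_map.
have Df := (E _ clfg).1; have Eg : g = closure_map M f := (E _ clfg).2.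
have cl0 := E _ (subset_closure (graph_linear lM).1).
have E0 : 0 = closure_map M 0 := cl0.2.
have Pg0 : P g = 0 by have := cP f 0 Df cl0.1; rewrite Pf0 P0 Eg -E0 P0; apply.
have x'g : (x' (P (M h)) @[h --> U]) --> (0 : K).
  have := gP _ (dual_comp bP dx'); rewrite /= Pg0.
  by rewrite -[X in x' X](subrr 0) (dualB dx') subrr.
move/cvgrPdist_lt/(_ _ eps0) : x'g => x'g.
have [h [/= + [_ _ _ _]]] := @filter_ex _ U _ _ (filterI x'g US1).
by rewrite sub0r normrN.
Qed.

Lemma strong_compatible_closure :
  norm_strongly_compatible P M -> compatible P (closure_map M).
Proof.
move=> sP f g Df Dg Pfg.
have E h : pm_dom (closure_map M) h -> closure (graph M) (h, closure_map M h).
  by move=> Dh; rewrite -graph_closure_map.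
set a := closure_map M f; set b := closure_map M g.
apply/eqP; rewrite -subr_eq0; apply/eqP.
apply: dual_separates => x' dx'; apply/eqP; rewrite -normr_le0.
apply/ler_addgt0Pr => e e0; rewrite add0r.
have [C C0 PC] := bounded_operator_ge0 bP.
have [_ [B [B0 x'B]]] := dual_comp bP dx'.
(* One ball for both approximants: each of the two norms in a graph norm grows by less than 1, hence
   the summand 2. *)
pose r := `|f| + `|a| + (`|g| + `|b|) + 2.
have r0 : 0 < r by rewrite ltr_wpDl// !addr_ge0.
have e20 : 0 < e / 2 by rewrite divr_gt0.
have [d d0 sPd] := sP r x' r0 dx' _ e20.
have approx h (eta : K) : pm_dom (closure_map M) h -> 0 < eta ->
    exists2 h', pm_dom M h' & `|h - h'| < eta /\ `|closure_map M h - M h'| < eta.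
  move=> /E/closure_normP H /H[[h' _] [/= Dh' ->]].
  rewrite prod_normE /= comparable_gt_max ?real_comparable ?normr_real// => /andP[? ?].
  by exists h'.
have C1 : 0 < (C + 1) * 2 by rewrite mulr_gt0// ltr_wpDl.
have B1 : 0 < (B + 1) * 2 by rewrite mulr_gt0// ltr_wpDl.
(* The first bound on [c] will keep the approximants [d]-close under [P], the second keeps the
   functional's error within e / 2; [eta] is also at most 1 for the ball. *)
have [c c0 [cd ce]] := pos_le2 (divr_gt0 d0 C1) (divr_gt0 e20 B1).
have [eta eta0 [etac eta1]] := pos_le2 c0 ltr01.
have eta2 : eta + eta = 2 * eta by rewrite mulr_natl mulr2n.
have etad : C * eta + C * eta < d.
  rewrite -mulrDr; apply: (@lt_le_trans _ _ ((C + 1) * (eta + eta))).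
    by rewrite ltr_pM2r ?addr_gt0// ltrDl.
  by rewrite eta2 mulrA mulrC -ler_pdivlMr// (le_trans etac).
have etae : B * eta + B * eta <= e / 2.
  rewrite -mulrDr; apply: (@le_trans _ _ ((B + 1) * (eta + eta))).
    by rewrite ler_pM2r ?addr_gt0// lerDl.
  by rewrite eta2 mulrA mulrC -ler_pdivlMr// (le_trans etac).
have [f' Df' [ff' aMf']] := approx f eta Df eta0.
have [g' Dg' [gg' bMg']] := approx g eta Dg eta0.
have near_norm (x y : X) : `|x - y| < eta -> `|y| < `|x| + 1.
  move=> xy; rewrite -[y](subKr x); apply: le_lt_trans (ler_normB _ _) _.
  by rewrite ltrD2l (lt_le_trans xy).
have fr : graph_ball M r f'.
  split=> //; apply: lt_le_trans (ltrD (near_norm _ _ ff') (near_norm _ _ aMf')) _.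
  by rewrite addrACA -/a /r lerD// lerDl addr_ge0.
have gr : graph_ball M r g'.
  split=> //; apply: lt_le_trans (ltrD (near_norm _ _ gg') (near_norm _ _ bMg')) _.
  by rewrite addrACA -/b /r lerD// lerDr addr_ge0.
have Pfg' : `|P (f' - g')| < d.
  have -> : P (f' - g') = P (g - g') - P (f - f').
    by rewrite !(bounded_operatorB bP) Pfg opprB [RHS]addrC [RHS]addrA subrK.
  apply: le_lt_trans (ler_normB _ _) (le_lt_trans _ etad).
  by apply: lerD; apply: le_trans (PC _) _; rewrite ler_wpM2l// ltW.
rewrite -(bounded_operatorB bP) -[x' (P _)]/((x' \o P) (a - b)).
(* The first two differences are approximation errors costing e / 2 together; uniform continuity
   bounds the third by e / 2. *)
have -> : a - b = (a - M f') - (b - M g') + (M f' - M g').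
  by rewrite opprB addrACA [a - M f' + M f']subrK [M g' - b - M g']addrAC subrr sub0r.
have dxP := dual_comp bP dx'.
rewrite -[X in X + (M f' - M g')]scale1r dxP.1 mul1r (dualB dxP) [leRHS]splitr.
apply: le_trans (ler_normD _ _) (lerD _ (ltW (sPd _ _ fr gr Pfg'))).
apply: le_trans (ler_normB _ _) (le_trans _ etae).
by apply: lerD; apply: le_trans (x'B _) _; rewrite ler_wpM2l// ltW.
Qed.

End Compatibility.

Theorem theorem1p0p2 (R : realType) (k : scalar_kind)
    (X : completeNormedModType (scalar_field R k))
    (P : X -> X) (M : partial_map X) :
  reflexive_space X -> bounded_operator P ->
  linear_partial_map M -> closable M ->
  (compatible P (closure_map M) <-> norm_strongly_compatible P M).
Proof.
move=> reflX bP lM clM; split; first exact: compatible_closure_strong.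
exact: strong_compatible_closure.
Qed.
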